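(* Fix integers $m\ge2$ and $D\ge0$. The equality $$A_{m-1}(D)=M_{m-1}(D)$$ is equivalent to the following statement: for all sufficiently large $K$, every $(K-D)$-intersecting family $F\subseteq\Omega_{m,K}$ satisfies $|F|\le M_{m-1}(D)$. Moreover, the bound $M_{m-1}(D)$ is attained (by some $(K-D)$-intersecting family $F\subseteq\Omega_{m,K}$) for all sufficiently large $K$.
   Context: For $u\in\mathbb{R}$ put $u^+=\max\{u,0\}$. The asymmetric Manhattan metric on $\mathbb{Z}^n$ is $d_{\mathrm a}(x,y)=\max\{\sum_{i=1}^n(x_i-y_i)^+,\ \sum_{i=1}^n(y_i-x_i)^+\}$. Let $A_n(D)$ be the maximum cardinality of a set $F\subseteq\mathbb{Z}^n$ of $d_{\mathrm a}$-diameter at most $D$. For nonnegative integers $P,Q$, $S_n(P,Q)=\{x\in\mathbb{Z}^n:\sum_i x_i^+\le P,\ \sum_i(-x_i)^+\le Q\}$. Put $P_D=\lceil D/2\rceil$, $Q_D=\lfloor D/2\rfloor$, $S_{n,D}=S_n(P_D,Q_D)$, and $$M_n(D)=|S_{n,D}|=\sum_{j=0}^n\binom nj\binom{P_D}{j}\binom{Q_D+n-j}{n-j}.$$ (The conjecture that $A_n(D)=M_n(D)$ for all $n,D$ is the general optimal-anticode conjecture; the displayed equality is its instance in dimension $m-1$ with diameter $D$.) For integers $m\ge2$, $K\ge0$, $\Omega_{m,K}=\{a\in\mathbb{Z}_{\ge0}^m:\sum_{i=1}^m a_i=K\}$ (the $K$-multisets on an $m$-element ground set), and for $a,b\in\Omega_{m,K}$,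 $|a\wedge b|=\sum_{i=1}^m\min(a_i,b_i)$. A family $F\subseteq\Omega_{m,K}$ is $(K-D)$-intersecting if $|a\wedge b|\ge K-D$ for all $a,b\in F$. *)

(* Defs.v *)
From mathcomp Require Import all_boot all_order all_algebra finmap.
From mathcomp Require Import mathcomp_extra boolp classical_sets functions cardinality.
From mathcomp Require Import zify.

Set Implicit Arguments.
Unset Strict Implicit.
Unset Printing Implicit Defensive.

Import Order.TTheory GRing.Theory Num.Theory.
Local Open Scope classical_set_scope.
Local Open Scope card_scope.
Local Open Scope ring_scope.

Definition pospart (u : int) : int := Num.max u 0.

Definition asym_dist (n : nat) (x y : {ffun 'I_n -> int}) : int :=
  Num.max (\sum_(i < n) pospart (x i - y i)) (\sum_(i < n) pospart (y i - x i)).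

Definition diam_le (n D : nat) (F : set {ffun 'I_n -> int}) : Prop :=
  forall x y, F x -> F y -> asym_dist x y <= D%:Z.

Definition is_max_anticode_card (n D k : nat) : Prop :=
  (exists F : set {ffun 'I_n -> int}, diam_le D F /\ F #= `I_k) /\
  (forall F : set {ffun 'I_n -> int}, diam_le D F -> F #<= `I_k).

Lemma pospart_ge0 u : 0 <= pospart u.
Proof. by rewrite /pospart le_max lexx orbT. Qed.

Lemma le_pospart u : u <= pospart u.
Proof. by rewrite /pospart le_max lexx. Qed.

Lemma pospart_le_sum n (f : 'I_n -> int) i :
  pospart (f i) <= \sum_(j < n) pospart (f j).
Proof.
rewrite (bigD1 i) //= lerDl; apply: sumr_ge0 => j _; exact: pospart_ge0.
Qed.

Lemma is_max_anticode_card_exists (n D : nat) :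
  exists k, is_max_anticode_card n D k.
Proof.
pose T := {ffun 'I_n -> 'I_(D + D).+1}.
have [B leB] : exists B, [set: T] #<= `I_B.
  exact/finite_set_leP/finite_finset.
have bnd (F : set {ffun 'I_n -> int}) : diam_le D F -> F #<= `I_B.
  move=> dF; have [->|/set0P[x0 Fx0]] := eqVneq F set0; first exact: card_ge0.
  pose g (h : T) : {ffun 'I_n -> int} := [ffun i => x0 i + (h i : nat)%:Z - D%:Z].
  apply: (@card_le_trans _ _ _ (g @` setT)).
    apply: subset_card_le => x Fx /=.
    have hx i : `|x i - x0 i| <= D%:Z.
      have := dF _ _ Fx Fx0; rewrite /asym_dist ge_max => /andP[h1 h2].
      have := le_trans (pospart_le_sum (fun i => x i - x0 i) i) h1.
      have := le_trans (pospart_le_sum (fun i => x0 i - x i) i) h2.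
      have := le_pospart (x i - x0 i); have := le_pospart (x0 i - x i).
      lia.
    exists [ffun i => inord (absz (x i - x0 i + D%:Z))] => //.
    apply/ffunP => i; rewrite !ffunE inordK; have := hx i; move: (x i) (x0 i) => u v; lia.
  exact: card_le_trans (card_image_le _ _) leB.
pose P k := `[< exists F : set {ffun 'I_n -> int}, diam_le D F /\ F #= `I_k >].
have P0 : exists k, P k.
  exists 0%N; apply/asboolP; exists set0; split=> [x y []|].
  by rewrite II0.
have PB k : P k -> (k <= B)%N.
  move=> /asboolP[F [dF Fk]].
  by rewrite -card_le_II -(card_le_eql Fk) bnd.
case: (ex_maxnP P0 PB) => k /asboolP Pk maxk; exists k; split=> // F dF.
have /finite_setP[j Fj] : finite_set F by apply/finite_set_leP; exists B; exact: bnd.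
rewrite (card_le_eql Fj) card_le_II; apply: maxk; apply/asboolP; by exists F.
Qed.

Definition max_anticode (n D : nat) : nat :=
  projT1 (cid (is_max_anticode_card_exists n D)).

Lemma max_anticodeP (n D : nat) : is_max_anticode_card n D (max_anticode n D).
Proof. exact: (projT2 (cid (is_max_anticode_card_exists n D))). Qed.

Definition anticode_ball (n P Q : nat) : set {ffun 'I_n -> int} :=
  [set x | \sum_(i < n) pospart (x i) <= P%:Z /\
           \sum_(i < n) pospart (- x i) <= Q%:Z].

Arguments anticode_ball : clear implicits.

Definition ball_card (n D : nat) : nat :=
  #|` fset_set (anticode_ball n (uphalf D) (D./2))|.

Definition fcons (n : nat) (v : int) (y : {ffun 'I_n -> int}) :
    {ffun 'I_n.+1 -> int} :=
  [ffun i => if unlift ord0 i is Some j then y j else v].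

(* A duplicate-free enumeration of the anticode ball, only used to count it. *)
Fixpoint ball_seq (n P Q : nat) : seq {ffun 'I_n -> int} :=
  if n is n'.+1 then
    [seq fcons p%:Z y | p <- iota 1 P, y <- ball_seq n' (P - p) Q] ++
    [seq fcons (- q%:Z) y | q <- iota 0 Q.+1, y <- ball_seq n' P (Q - q)]
  else [:: [ffun=> 0]].

Lemma ball_seqS n P Q : ball_seq n.+1 P Q =
  [seq fcons p%:Z y | p <- iota 1 P, y <- ball_seq n (P - p) Q] ++
  [seq fcons (- q%:Z) y | q <- iota 0 Q.+1, y <- ball_seq n P (Q - q)].
Proof. by []. Qed.

Lemma ball_seqP n P Q x : x \in ball_seq n P Q <-> anticode_ball n P Q x.
Proof.
elim: n P Q x => [|n IH] P Q x.
  rewrite /anticode_ball /= !big_ord0; split=> // _.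
  by rewrite inE; apply/eqP/ffunP; case.
have E0 v (y : {ffun 'I_n -> int}) : fcons v y ord0 = v.
  by rewrite ffunE unlift_none.
have ES v (y : {ffun 'I_n -> int}) i : fcons v y (lift ord0 i) = y i.
  by rewrite ffunE liftK.
have Ex : x = fcons (x ord0) [ffun i => x (lift ord0 i)].
  apply/ffunP => i; case: (unliftP ord0 i) => [j|] ->; last by rewrite E0.
  by rewrite ES ffunE.
have BS v (y : {ffun 'I_n -> int}) p q : pospart v = p%:Z -> pospart (- v) = q%:Z ->
    (p <= P)%N -> (q <= Q)%N ->
    anticode_ball n.+1 P Q (fcons v y) <-> anticode_ball n (P - p) (Q - q) y.
  move=> hp hq lp lq; rewrite /anticode_ball /= !big_ord_recl !E0 hp hq.
  have -> : \sum_(i < n) pospart (fcons v y (lift ord0 i)) = \sum_(i < n) pospart (y i).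
    by apply: eq_bigr => i _; rewrite ES.
  have -> : \sum_(i < n) pospart (- fcons v y (lift ord0 i)) =
      \sum_(i < n) pospart (- y i).
    by apply: eq_bigr => i _; rewrite ES.
  move: (\sum_(i < n) _) (\sum_(i < n) _) => s t; split=> -[h1 h2]; split; lia.
rewrite ball_seqS mem_cat; split.
  case/orP => /(@allpairsPdep _ (fun=> {ffun 'I_n -> int}))[p [y [+ /IH yL ->]]];
    rewrite mem_iota => pP.
    by apply/(BS _ _ p 0%N); rewrite ?subn0 // /pospart; lia.
  by apply/(BS _ _ 0%N p); rewrite ?subn0 // /pospart; lia.
move=> Bx; have Bx' := Bx; rewrite /anticode_ball /= !big_ord_recl in Bx'.
case: Bx' => h1 h2.
have {}h1 : pospart (x ord0) <= P%:Z.
  by apply: le_trans h1; rewrite lerDl; apply: sumr_ge0 => i _; exact: pospart_ge0.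
have {}h2 : pospart (- x ord0) <= Q%:Z.
  by apply: le_trans h2; rewrite lerDl; apply: sumr_ge0 => i _; exact: pospart_ge0.
move: Bx; rewrite {1 2 3}Ex; case: (ltrP 0 (x ord0)) => s Bx; apply/orP; [left|right];
  apply/(@allpairsPdep _ (fun=> {ffun 'I_n -> int})); exists (absz (x ord0)); exists [ffun i => x (lift ord0 i)]; split.
- by rewrite mem_iota; move: h1 h2 s; rewrite /pospart; move: (x ord0) => u; lia.
- by apply/IH; move: Bx; rewrite (BS _ _ (absz (x ord0)) 0%N) ?subn0 //;
    move: h1 h2 s; rewrite /pospart; move: (x ord0) => u; lia.
- by congr fcons; move: (x ord0) s => u; lia.
- by rewrite mem_iota; move: h1 h2 s; rewrite /pospart; move: (x ord0) => u; lia.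
- by apply/IH; move: Bx; rewrite (BS _ _ 0%N (absz (x ord0))) ?subn0 //;
    move: h1 h2 s; rewrite /pospart; move: (x ord0) => u; lia.
- by congr fcons; move: (x ord0) s => u; lia.
Qed.

Lemma ball_seq_uniq n P Q : uniq (ball_seq n P Q).
Proof.
have I v w k (y z : {ffun 'I_k -> int}) : fcons v y = fcons w z -> v = w /\ y = z.
  move=> /ffunP e; split; first by have := e ord0; rewrite !ffunE unlift_none.
  by apply/ffunP => i; have := e (lift ord0 i); rewrite !ffunE liftK.
elim: n P Q => [|n IH] P Q //; rewrite ball_seqS cat_uniq; apply/and3P; split.
- apply: allpairs_uniq_dep; rewrite ?iota_uniq // => -[p y] [q z] _ _ /= /I[].
  by case=> -> ->.
- apply/hasPn => x /(@allpairsPdep _ (fun=> {ffun 'I_n -> int}))[q [y [_ _ ->]]]; apply/negP.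
  by case/(@allpairsPdep _ (fun=> {ffun 'I_n -> int}))=> p [z []]; rewrite mem_iota => + _ /I[]; lia.
- apply: allpairs_uniq_dep; rewrite ?iota_uniq // => -[p y] [q z] _ _ /= /I[e ->].
  by have -> : p = q by lia.
Qed.

Lemma sum_bin_sub (N j : nat) :
  (\sum_(1 <= p < N.+1) 'C(N - p, j) = 'C(N, j.+1))%N.
Proof.
elim: N => [|N IH]; first by rewrite big_geq.
by rewrite big_nat_recl // subSS subn0 binS -IH addnC.
Qed.

Lemma sum_bin_add (N k : nat) :
  (\sum_(0 <= q < N.+1) 'C(N - q + k, k) = 'C(N + k.+1, k.+1))%N.
Proof.
elim: N => [|N IH]; first by rewrite big_nat1 !add0n !binn.
by rewrite big_nat_recl // subn0 (addSn _ k.+1) binS -IH addnC addnS.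
Qed.

Lemma size_ball_seq n P Q : size (ball_seq n P Q) =
  (\sum_(0 <= j < n.+1) 'C(n, j) * 'C(P, j) * 'C(Q + n - j, n - j))%N.
Proof.
elim: n P Q => [|n IH] P Q; first by rewrite big_nat1 !bin0.
rewrite ball_seqS size_cat !size_allpairs_dep !sumnE !big_map.
have -> : iota 1 P = index_iota 1 P.+1 by rewrite /index_iota subn1.
rewrite -[iota 0 Q.+1]/(index_iota 0 Q.+1).
have -> : (\sum_(1 <= p < P.+1) size (ball_seq n (P - p) Q) =
    \sum_(0 <= j < n.+1) 'C(n, j) * 'C(P, j.+1) * 'C(Q + n - j, n - j))%N.
  under eq_bigr do rewrite IH.
  rewrite exchange_big /=; apply: eq_bigr => j _.
  by rewrite -sum_bin_sub big_distrr big_distrl.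
have -> : (\sum_(0 <= q < Q.+1) size (ball_seq n P (Q - q)) =
    \sum_(0 <= j < n.+1) 'C(n, j) * 'C(P, j) * 'C(Q + n.+1 - j, n.+1 - j))%N.
  under eq_bigr do rewrite IH.
  rewrite exchange_big /=; apply: eq_big_nat => j /andP[_ ltjn].
  rewrite -big_distrr /= -addnBA 1?ltnW // subSn // -sum_bin_add; congr (_ * _)%N.
  by apply: eq_bigr => q _; rewrite addnBA.
rewrite [RHS]big_nat_recl // !bin0 !mul1n.
rewrite [X in (_ + X)%N]big_nat_recl // !bin0 !mul1n addnCA; congr (_ + _)%N.
have -> : (\sum_(0 <= i < n) 'C(n, i.+1) * 'C(P, i.+1) * 'C(Q + n.+1 - i.+1, n.+1 - i.+1) =
    \sum_(0 <= i < n.+1) 'C(n, i.+1) * 'C(P, i.+1) * 'C(Q + n - i, n - i))%N.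
  rewrite big_nat_recr //= (bin_small (ltnSn n)) !mul0n addn0.
  by apply: eq_bigr => i _; rewrite addnS !subSS.
rewrite -big_split /=; apply: eq_bigr => i _.
by rewrite addnS !subSS binS !mulnDl addnC.
Qed.

Lemma ball_cardE n D : ball_card n D =
  (\sum_(j < n.+1) 'C(n, j) * 'C(uphalf D, j) * 'C(D./2 + n - j, n - j))%N.
Proof.
rewrite -(big_mkord xpredT (fun j => 'C(n, j) * 'C(uphalf D, j) * 'C(D./2 + n - j, n - j))%N).
rewrite -size_ball_seq /ball_card.
have -> : anticode_ball n (uphalf D) D./2 =
    [set` [fset x in ball_seq n (uphalf D) D./2]%fset].
  by apply/seteqP; split=> x /=; rewrite inE /= => /ball_seqP.
by rewrite set_fsetK card_fseq undup_id // ball_seq_uniq.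
Qed.

Definition msets (m K : nat) : set {ffun 'I_m -> nat} :=
  [set a | (\sum_(i < m) a i)%N = K].

Arguments msets : clear implicits.

Definition mset_meet (m : nat) (a b : {ffun 'I_m -> nat}) : nat :=
  (\sum_(i < m) minn (a i) (b i))%N.

(* The threshold K - D can be passed as a truncated difference: if K < D, both 0
   and the negative integer K - D impose no condition. *)
Definition intersecting (m t : nat) (F : set {ffun 'I_m -> nat}) : Prop :=
  forall a b, F a -> F b -> (t <= mset_meet a b)%N.

(* Main.v *)
Require Import Defs.
From mathcomp Require Import all_boot all_order all_algebra finmap.
From mathcomp Require Import boolp classical_sets functions cardinality.
From mathcomp Require Import zify.

Local Open Scope classical_set_scope.
Local Open Scope card_scope.
Local Open Scope nat_scope.

Import Order.TTheory GRing.Theory Num.Theory.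

(** Forgetting the first multiplicity identifies the K-multisets with points of
    Z^(m-1), and since a and b have the same total, K - |a /\ b| is exactly the
    asymmetric Manhattan distance of the images. So intersecting families are
    anticodes; conversely a finite anticode, translated into the nonnegative
    orthant, lifts to multisets once K exceeds all its coordinate sums. The ball
    S_(n,D) is itself an anticode, which yields the lower bounds. *)

Definition drop_first {n : nat} (a : {ffun 'I_n.+1 -> nat}) : {ffun 'I_n -> int} :=
  [ffun j => (a (lift ord0 j))%:Z]%R.

Definition shift {n : nat} (c : int) (x : {ffun 'I_n -> int}) : {ffun 'I_n -> int} :=
  [ffun j => x j + c]%R.

(** Termwise, the positive part of u - v is u - min(u, v). *)
Lemma sum_pospart_sub (n : nat) (f g : 'I_n -> nat) :
  (\sum_(i < n) pospart ((f i)%:Z - (g i)%:Z) =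
   (\sum_(i < n) f i)%N%:Z - (\sum_(i < n) minn (f i) (g i))%N%:Z)%R.
Proof.
elim: n f g => [|n IH] f g; first by rewrite !big_ord0.
by rewrite !big_ord_recl IH /pospart; lia.
Qed.

(** If s is the meet over the kept coordinates, the two one-sided sums are K - a_0 - s and K - b_0 -
    s. Their maximum is K - min(a_0, b_0) - s, and min(a_0, b_0) is the term that completes s to the
    full meet. *)
Lemma asym_dist_drop_first (n K : nat) (a b : {ffun 'I_n.+1 -> nat}) :
  msets n.+1 K a -> msets n.+1 K b ->
  (asym_dist (drop_first a) (drop_first b) = K%:Z - (mset_meet a b)%:Z)%R.
Proof.
rewrite /msets /= => sa sb; rewrite /asym_dist /mset_meet.
under eq_bigr do rewrite !ffunE.
under [X in Num.max _ X]eq_bigr do rewrite !ffunE.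
have minC : \sum_(i < n) minn (b (lift ord0 i)) (a (lift ord0 i)) =
    \sum_(i < n) minn (a (lift ord0 i)) (b (lift ord0 i)).
  by apply: eq_bigr => i _; rewrite minnC.
rewrite !sum_pospart_sub minC; move: sa sb; rewrite !big_ord_recl; lia.
Qed.

(** The fixed total K recovers the forgotten multiplicity. *)
Lemma drop_first_inj (n K : nat) : {in msets n.+1 K &, injective (@drop_first n)}.
Proof.
move=> a b; rewrite !inE /msets /= !big_ord_recl => sa sb /ffunP e.
have {}e (j : 'I_n) : a (lift ord0 j) = b (lift ord0 j) by have := e j; rewrite !ffunE => -[].
apply/ffunP => i; case: (unliftP ord0 i) => [j|] -> //.
have E : \sum_(j < n) a (lift ord0 j) = \sum_(j < n) b (lift ord0 j) by exact: eq_bigr.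
by apply: (@addIn (\sum_(j < n) b (lift ord0 j))); rewrite sb -sa E.
Qed.

Lemma intersecting_diam_le (n D K : nat) (F : set {ffun 'I_n.+1 -> nat}) :
  F `<=` msets n.+1 K ->
  intersecting (K - D) F <-> diam_le D (drop_first @` F).
Proof.
move=> FK; split=> [iF _ _ [a Fa <-] [b Fb <-]|dF a b Fa Fb].
  rewrite (asym_dist_drop_first _ _ _ _ (FK _ Fa) (FK _ Fb)).
  by have := iF _ _ Fa Fb; lia.
have := dF _ _ (imageP _ Fa) (imageP _ Fb).
by rewrite (asym_dist_drop_first _ _ _ _ (FK _ Fa) (FK _ Fb)); lia.
Qed.

Lemma card_drop_first (n K : nat) (F : set {ffun 'I_n.+1 -> nat}) :
  F `<=` msets n.+1 K -> drop_first @` F #= F.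
Proof.
move=> FK; apply: inj_card_eq => a b /set_mem Fa /set_mem Fb.
by apply: (@drop_first_inj n K); apply/mem_set/FK.
Qed.

Lemma diam_le_shift (n D : nat) (c : int) (G : set {ffun 'I_n -> int}) :
  diam_le D G -> diam_le D (shift c @` G).
Proof.
move=> dG _ _ [x Gx <-] [y Gy <-]; have := dG _ _ Gx Gy; rewrite /asym_dist.
have E (u v : {ffun 'I_n -> int}) :
    (\sum_(i < n) pospart (shift c u i - shift c v i) =
     \sum_(i < n) pospart (u i - v i))%R.
  by apply: eq_bigr => i _; rewrite !ffunE; congr pospart; lia.
by rewrite !E.
Qed.

Lemma card_shift (n : nat) (c : int) (G : set {ffun 'I_n -> int}) :
  shift c @` G #= G.
Proof.
apply: inj_card_eq => x y _ _ /ffunP e; apply/ffunP => i.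
by have := e i; rewrite !ffunE => /addIr.
Qed.

Lemma finite_coord_bounded (n : nat) (G : set {ffun 'I_n -> int}) :
  finite_set G -> exists c : nat, forall x, G x -> forall i, absz (x i) <= c.
Proof.
move=> /finite_seqP[s ->]; exists (\sum_(x <- s) \sum_i absz (x i)) => x /= xs i.
by rewrite (big_rem x) //= (bigD1 i) //= -!addnA leq_addr.
Qed.

Lemma anticode_lift (n D : nat) (G : set {ffun 'I_n -> int}) :
  finite_set G -> diam_le D G ->
  exists K0 : nat, forall K : nat, K0 <= K ->
    exists F : set {ffun 'I_n.+1 -> nat},
      [/\ F `<=` msets n.+1 K, intersecting (K - D) F & F #= G].
Proof.
move=> /finite_coord_bounded[c Gc] dG; exists (n * (c + c)) => K leK.
(* Taking the full preimage reduces everything to surjectivity onto the translate of [G]. *)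
pose F := msets n.+1 K `&` (drop_first @^-1` (shift c%:Z @` G)).
have FK : F `<=` msets n.+1 K by move=> a [].
have dropF : drop_first @` F = shift c%:Z @` G.
  apply/seteqP; split=> [_ [a [_ Ga] <-] //|_ [x Gx <-]].
  (* As [c] bounds every |x_j|, each x_j + c lies between 0 and 2c: [absz] loses nothing, and the n
     entries sum to at most the threshold n(c + c). The first multiplicity absorbs the remainder. *)
  pose t j := absz (x j + c%:Z)%R.
  have st : \sum_(j < n) t j <= K.
    apply: leq_trans leK; rewrite -[X in X * _]card_ord -sum_nat_const.
    by apply: leq_sum => j _; rewrite /t; have := Gc _ Gx j; lia.
  pose a : {ffun 'I_n.+1 -> nat} :=
    [ffun i => if unlift ord0 i is Some j then t j else K - \sum_(j < n) t j].
  have dropa : drop_first a = shift c%:Z x.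
    apply/ffunP => j; rewrite !ffunE liftK /t.
    by have := Gc _ Gx j; lia.
  exists a => //; split; last by rewrite /preimage /= dropa; exact: imageP.
  rewrite /msets /= big_ord_recl ffunE unlift_none.
  have -> : \sum_(j < n) a (lift ord0 j) = \sum_(j < n) t j.
    by apply: eq_bigr => j _; rewrite ffunE liftK.
  by rewrite subnK.
exists F; split=> //.
  by apply/intersecting_diam_le => //; rewrite dropF; exact: diam_le_shift.
rewrite -(card_eqr (card_shift n c G)) -dropF card_eq_sym.
exact: card_drop_first FK.
Qed.

(** Triangle inequality through the origin: the positive part of u - v is at most that of u plus
    that of -v. *)
Lemma diam_le_anticode_ball (n P Q : nat) : diam_le (P + Q) (anticode_ball n P Q).
Proof.
have E (x y : {ffun 'I_n -> int}) : (\sum_(i < n) pospart (x i - y i) <=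
    \sum_(i < n) pospart (x i) + \sum_(i < n) pospart (- y i))%R.
  by rewrite -big_split; apply: ler_sum => i _; rewrite /pospart /=; lia.
move=> x y [xP xQ] [yP yQ]; rewrite /asym_dist ge_max; apply/andP.
by split; apply: le_trans (E _ _) _; rewrite PoszD; [|rewrite addrC]; lia.
Qed.

Lemma finite_anticode_ball (n P Q : nat) : finite_set (anticode_ball n P Q).
Proof.
by apply/finite_seqP; exists (ball_seq n P Q); apply/seteqP; split=> x /ball_seqP.
Qed.

Lemma diam_le_ball (n D : nat) : diam_le D (anticode_ball n (uphalf D) D./2).
Proof.
have := @diam_le_anticode_ball n (uphalf D) D./2.
by rewrite uphalf_half -addnA addnn odd_double_half.
Qed.

(** Finiteness of the ball matters here: [fset_set] is empty by default on infinite sets. *)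
Lemma card_anticode_ball (n D : nat) :
  anticode_ball n (uphalf D) D./2 #= `I_(ball_card n D).
Proof.
have /finite_setP[k ck] := finite_anticode_ball n (uphalf D) D./2.
by rewrite /ball_card (card_fset_set ck).
Qed.

Theorem proposition7p2 (m D : nat) (hm : 2 <= m) :
  (max_anticode m.-1 D = ball_card m.-1 D <->
     exists K0 : nat, forall K : nat, K0 <= K ->
       forall F : set {ffun 'I_m -> nat},
         F `<=` msets m K -> intersecting (K - D) F ->
         F #<= `I_(ball_card m.-1 D))
  /\
  (exists K0 : nat, forall K : nat, K0 <= K ->
     exists F : set {ffun 'I_m -> nat},
       [/\ F `<=` msets m K, intersecting (K - D) F
         & F #= `I_(ball_card m.-1 D)]).
Proof.
case: m hm => // n _ /=.
have [[G [dG cG]] maxG] := max_anticodeP n D.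
split; first split.
(* This direction holds for every K, so the threshold is 0. *)
- move=> <-; exists 0 => K _ F FK iF.
  rewrite -(card_le_eql (card_drop_first _ _ _ FK)); apply: maxG.
  exact/(intersecting_diam_le _ _ _ _ FK).
- move=> [K1 HK]; apply/eqP; rewrite eqn_leq; apply/andP; split; last first.
    rewrite -card_le_II -(card_le_eql (card_anticode_ball n D)).
    exact/maxG/diam_le_ball.
  (* Lift an extremal anticode [G] at a total beyond both its own threshold [K2] and the threshold
     [K1] of the assumed bound. *)
  have finG : finite_set G by apply/finite_setP; exists (max_anticode n D).
  have [K2 /(_ (maxn K1 K2) (leq_maxr _ _))[F [FK iF cF]]] := anticode_lift _ _ _ finG dG.
  rewrite -card_le_II -(card_le_eql cG) -(card_le_eql cF).
  exact: HK (leq_maxl _ _) _ FK iF.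
- have [K0 HK] := anticode_lift _ _ _ (finite_anticode_ball n _ _) (diam_le_ball n D).
  exists K0 => K /HK[F [FK iF cF]]; exists F; split=> //.
  exact: card_eq_trans cF (card_anticode_ball n D).
Qed.
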